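(* Let $H$ be a complex Hilbert space. For each $n\in\mathbb{N}$ let $V_n$ be a Hilbert space, $j_n\colon V_n\to H$ a bounded linear map with dense range and $a_n\colon V_n\times V_n\to\mathbb{C}$ a positive $j_n$-elliptic form; let $V$ be a Hilbert space, $j\colon V\to H$ a bounded linear map with dense range and $a\colon V\times V\to\mathbb{C}$ a positive $j$-elliptic form. Let $A_n$ and $A$ be the self-adjoint operators on $H$ associated with $(a_n,j_n)$ and $(a,j)$, respectively. Then the following are equivalent. (a) The sequence $(-A_n)_{n\in\mathbb{N}}$ converges to $-A$ in the strong resolvent sense. (b) The following two conditions are satisfied: (i) If $u_n\in V_n$ for $n\in\mathbb{N}$, $j_n(u_n)\rightharpoonup x$ weakly in $H$ for some $x\in H$ and $\liminf_{n\to\infty}a_n(u_n,u_n)<\infty$, then there exists $u\in V$ such that $j(u)=x$ and $\liminf_{n\to\infty}a_n(u_n,u_n)\ge a(u,u)$; (ii) For all $u\in V$ there exists a sequence $(u_n)_{n\in\mathbb{N}}$ with $u_n\in V_n$ such that $\lim_{n\to\infty}j_n(u_n)=j(u)$ in $H$ and $\limsup_{n\to\infty}a_n(u_n,u_n)\le a(u,u)$.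
   Context: Let $V,H$ be Hilbert spaces and $j\colon V\to H$ bounded linear with dense range. A sesquilinear form $a\colon V\times V\to\mathbb{C}$ is $j$-elliptic if it is continuous and there exist $\omega\in\mathbb{R}$, $\mu>0$ with $\operatorname{Re} a(u,u)-\omega\|j(u)\|_H^2\ge\mu\|u\|_V^2$ for all $u\in V$. It is positive if $a(u,u)\ge0$ for all $u\in V$ (and then it is symmetric). The operator $A$ on $H$ associated with $(a,j)$ is given by: $x\in D(A)$ and $Ax=f$ if and only if $x, f\in H$ and there exists $u\in V$ with $j(u)=x$ and $a(u,v)=(f\mid j(v))_H$ for all $v\in V$; it is self-adjoint when $a$ is symmetric. For the positive self-adjoint operators here, strong resolvent convergence of $-A_n$ to $-A$ means $(\lambda+A_n)^{-1}x\to(\lambda+A)^{-1}x$ in $H$ for all $x\in H$ and all $\lambda>0$. The constants $\omega,\mu$ for the forms $a_n$ are not assumed uniform in $n$. *)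

(* Defs.v *)
From HB Require Import structures.
From mathcomp Require Import all_boot all_order all_algebra.
From mathcomp Require Import complex.
From mathcomp Require Import all_classical all_reals all_analysis.

Set Implicit Arguments.
Unset Strict Implicit.
Unset Printing Implicit Defensive.

Import Order.TTheory GRing.Theory Num.Theory.
Import numFieldNormedType.Exports.

Local Open Scope classical_set_scope.
Local Open Scope ring_scope.
Local Open Scope complex_scope.

(* Inner products are linear in the first and conjugate-linear in the second
   argument. The norm of a normedModType over R[i] takes its (real) values
   in R[i]. *)
HB.mixin Record NormedModule_isHilbert (R : realType) (H : Type)
    of CompleteNormedModule R[i] H := {
  inner : {dot H for (@Num.conj R[i])} ;
  innerxx : forall x : H, inner x x = `|x| ^+ 2
}.

#[short(type="hilbertType")]
HB.structure Definition Hilbert (R : realType) :=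
  { H of NormedModule_isHilbert R H & CompleteNormedModule R[i] H }.

Notation "{ 'sesquilinear' V }" :=
  {bilinear V -> V -> _ | *%R & (@Num.conj _ \; *%R)}
  (at level 0, format "{ 'sesquilinear'  V }") : ring_scope.

Section Forms.
Variables (R : realType) (V H : hilbertType R).
Variables (j : {linear V -> H}) (a : {sesquilinear V}).

Definition bounded_operator := exists M : R, forall u, `|j u| <= M%:C * `|u|.

Definition dense_range := dense (range j).

Definition continuous_form :=
  continuous (fun uv : V * V => a uv.1 uv.2 : R[i]^o).

Definition elliptic := continuous_form /\
  exists omega mu : R, 0 < mu /\
    forall u, mu%:C * `|u| ^+ 2 <= (complex.Re (a u u))%:C - omega%:C * `|j u| ^+ 2.

(* The order of R[i] makes 0 <= z mean that z is real and nonnegative. *)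
Definition positive_form := forall u, 0 <= a u u.

(* For a positive form this is the real number a(u, u), seen in \bar R. *)
Definition qform (u : V) : \bar R := (complex.Re (a u u))%:E.

(* Unbounded operators are represented by their graphs. *)
Definition associated_operator : set (H * H) :=
  [set xf | exists u : V, j u = xf.1 /\ forall v, a u v = inner xf.2 (j v)].

End Forms.

Section Convergence.
Variables (R : realType) (H : hilbertType R).

Definition weak_cvg (x_ : nat -> H) (x : H) :=
  forall y, (fun n => inner (x_ n) y : R[i]^o) @ \oo --> (inner x y : R[i]^o).

(* (lambda + A)^{-1} x is the y in D(A) with lambda y + A y = x. It exists and
   is unique when A is positive and self-adjoint and 0 < lambda; the default
   value 0 of xget is then irrelevant. *)
Definition resolvent (A : set (H * H)) (lambda : R) (x : H) : H :=
  xget 0 [set y | exists2 f, A (y, f) & lambda%:C *: y + f = x].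

(* Strong resolvent convergence of -A_n to -A. *)
Definition strong_resolvent_cvg_opp (A_ : nat -> set (H * H)) (A : set (H * H)) :=
  forall (x : H) (lambda : R), 0 < lambda ->
    (fun n => resolvent (A_ n) lambda x) @ \oo --> resolvent A lambda x.

End Convergence.

(* Main.v *)
(* For a positive form, [(lam + A)^-1 (lam x)] is [j w] with [w] the minimizer of
   the strictly convex energy [a v v + lam |j v - x|^2]; so strong resolvent
   convergence is convergence of minimizers, and (b) is Mosco convergence of the
   forms. From (a), the lower bound in (i) is the tangent inequality at the
   minimizers [w_n] for [x]: in the limit it bounds the energies of the minimizers
   [w] by the inferior limit, uniformly in [lam], and these [w] converge in [V] as
   [lam -> oo]; for (ii) one takes the minimizers for [x = j u] with [lam -> oo]
   slowly. From (b), weak compactness and (i) bound the minimal energies from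
   below, (ii) bounds them from above, and strict convexity turns convergence of
   the energies into convergence of the minimizers.

   Everything is done with the real parts of the forms, as real bilinear forms. *)
Require Import Defs.
From HB Require Import structures.
From mathcomp Require Import all_boot all_order all_algebra.
From mathcomp Require Import complex ring lra.
From mathcomp Require Import all_classical all_reals all_analysis.
Import Order.TTheory GRing.Theory Num.Theory.
Import numFieldNormedType.Exports.
Local Open Scope classical_set_scope.
Local Open Scope ring_scope.
Local Open Scope complex_scope.

Set Implicit Arguments.
Unset Strict Implicit.

(** * Positive real bilinear forms *)

(** Only real scalars occur, acting through [t%:C], so that real parts of sesquilinear forms on a
    module over [R[i]] fit without restriction of scalars. *)
Record realForm (R : realType) (V : lmodType R[i]) := RealForm {
  rform :> V -> V -> R;
  rformDl : forall x y z, rform (x + y) z = rform x z + rform y z;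
  rformZl : forall (t : R) x z, rform (t%:C *: x) z = t * rform x z;
  rformC : forall x y, rform x y = rform y x;
  rform_ge0 : forall x, 0 <= rform x x }.

Section RealFormTheory.
Variables (R : realType) (V : lmodType R[i]) (b : realForm V).
Implicit Types (x y z : V) (t : R).

Lemma rformDr x y z : b x (y + z) = b x y + b x z.
Proof. by rewrite (rformC b x) rformDl !(rformC b x). Qed.

Lemma rformZr t x y : b x (t%:C *: y) = t * b x y.
Proof. by rewrite (rformC b x) rformZl (rformC b x). Qed.

Lemma rformNl x y : b (- x) y = - b x y.
Proof.
have -> : - x = (-1 : R)%:C *: x by rewrite rmorphN1 scaleN1r.
by rewrite rformZl mulN1r.
Qed.

Lemma rformNr x y : b x (- y) = - b x y.
Proof. by rewrite (rformC b x) rformNl (rformC b x). Qed.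

Lemma rform0l x : b 0 x = 0.
Proof.
have := rformDl b 0 0 x; rewrite addr0 => /eqP.
by rewrite -subr_eq subrr => /eqP.
Qed.

Definition rformE := (rformDl, rformDr, rformNl, rformNr, rformZl, rformZr).

Lemma rformDD x y : b (x + y) (x + y) = b x x + 2 * b x y + b y y.
Proof. by rewrite !rformE (rformC b y x); ring. Qed.

(** Discriminant of the nonnegative polynomial [H t]. The form may be degenerate: if [b y y = 0] the
    polynomial is affine, hence constant. *)
Lemma rform_CauchySchwarz x y : b x y ^+ 2 <= b x x * b y y.
Proof.
have H t : 0 <= b x x + 2 * t * b x y + t ^+ 2 * b y y.
  have := rform_ge0 b (x + t%:C *: y).
  by rewrite rformDD !rformE mulrA expr2 mulrA.
have [y0|y0] := eqVneq (b y y) 0.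
  have [->|xy0] := eqVneq (b x y) 0; first by rewrite y0 mulr0 expr0n.
  have := H (- (b x x + 1) / (2 * b x y)); rewrite y0 mulr0 addr0.
  have -> : 2 * (- (b x x + 1) / (2 * b x y)) * b x y = - (b x x + 1).
    by field.
  by lra.
have := H (- b x y / b y y).
have -> : b x x + 2 * (- b x y / b y y) * b x y + (- b x y / b y y) ^+ 2 * b y y
  = (b x x * b y y - b x y ^+ 2) / b y y by field.
have yp : 0 < b y y by rewrite lt_def y0 rform_ge0.
by rewrite pmulr_lge0 ?invr_gt0// subr_ge0.
Qed.

End RealFormTheory.

(** * Real parts of positive sesquilinear forms *)

Section RealPart.
Variables (R : realType) (V : lmodType R[i]) (a : {sesquilinear V}).
Hypothesis a_ge0 : forall u, 0 <= a u u.

Let Re_D (x y : R[i]) : complex.Re (x + y) = complex.Re x + complex.Re y.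
Proof. by case: x y => [? ?] [? ?]. Qed.

Let conjC_i : Num.conj ('i%C : R[i]) = - 'i%C.
Proof. by rewrite complexiE conjCi. Qed.

Fact Re_formDl x y z :
  complex.Re (a (x + y) z) = complex.Re (a x z) + complex.Re (a y z).
Proof. by rewrite linearDl Re_D. Qed.

Fact Re_formZl (t : R) x z : complex.Re (a (t%:C *: x) z) = t * complex.Re (a x z).
Proof. by rewrite linearZl_LR /=; case: (a x z) => p q /=; rewrite mul0r subr0. Qed.

(* Polarization: the imaginary parts of [a (x + y) (x + y)] and
   [a (x + 'i y) (x + 'i y)] vanish. *)
Fact Re_formC x y : complex.Re (a x y) = complex.Re (a y x).
Proof.
have h u : complex.Im (a u u) = 0 by apply: ger0_Im.
have := h (x + 'i%C *: y).
rewrite linearDl !linearDr /= !linearZl_LR /= !linearZr_LR /= conjC_i.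
have := h x; have := h y.
case: (a x y) (a y x) (a x x) (a y y) => [p p'] [q q'] [r r'] [s s'] /=.
by move=> -> -> h1; nra.
Qed.

Fact Re_form_ge0 x : 0 <= complex.Re (a x x).
Proof. by have := a_ge0 x; rewrite lecE => /andP[]. Qed.

Definition reForm : realForm V :=
  RealForm Re_formDl Re_formZl Re_formC Re_form_ge0.

End RealPart.

Section PullbackSum.
Variables (R : realType) (V H : lmodType R[i]) (j : {linear V -> H}).
Variables (b : realForm V) (c : realForm H) (t : R).
Hypothesis t0 : 0 <= t.

Let f u v := b u v + t * c (j u) (j v).

Fact pullbackDl x y z : f (x + y) z = f x z + f y z.
Proof. by rewrite /f linearD !rformDl mulrDr addrACA. Qed.

Fact pullbackZl (s : R) x z : f (s%:C *: x) z = s * f x z.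
Proof. by rewrite /f linearZ /= !rformZl mulrDr mulrCA. Qed.

Fact pullbackC x y : f x y = f y x.
Proof. by rewrite /f rformC (rformC c). Qed.

Fact pullback_ge0 x : 0 <= f x x.
Proof. by rewrite addr_ge0 ?mulr_ge0 ?rform_ge0. Qed.

(** With the inner product as [c], this is the bilinear form behind the energy. *)
Definition pullback_sum : realForm V :=
  RealForm pullbackDl pullbackZl pullbackC pullback_ge0.

End PullbackSum.

(** * The real inner product and the real norm of a Hilbert space *)

Section RealInner.
Variables (R : realType) (H : hilbertType R).
Implicit Types (x y z : H) (t e : R).

Definition nrm x : R := complex.Re `|x|.

Lemma nrmE x : `|x| = (nrm x)%:C.
Proof. by rewrite RRe_real. Qed.

Fact inner_ge0 x : 0 <= inner x x.
Proof. by rewrite innerxx exprn_ge0. Qed.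

Definition rin : realForm H := locked (reForm inner_ge0).

Lemma rinE x y : rin x y = complex.Re (inner x y).
Proof. by rewrite /rin -lock. Qed.

Lemma nrm_ge0 x : 0 <= nrm x.
Proof. by rewrite -ler0c -nrmE. Qed.

Lemma rinxx x : rin x x = nrm x ^+ 2.
Proof. by rewrite rinE innerxx nrmE -rmorphXn. Qed.

Lemma nrmD x y : nrm (x + y) <= nrm x + nrm y.
Proof. by have := ler_normD x y; rewrite !nrmE -rmorphD lecR. Qed.

Lemma nrmN x : nrm (- x) = nrm x.
Proof. by rewrite /nrm normrN. Qed.

Lemma nrmB x y : nrm (x - y) = nrm (y - x).
Proof. by rewrite /nrm distrC. Qed.

Lemma nrmZ t x : nrm (t%:C *: x) = `|t| * nrm x.
Proof.
apply: (@complexI R); rewrite -nrmE normrZ nrmE rmorphM /=; congr (_ * _).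
by rewrite normc_def /= expr0n addr0 sqrtr_sqr.
Qed.

Lemma nrm0 : nrm 0 = 0.
Proof. by rewrite /nrm normr0. Qed.

Lemma nrm_eq0 x : nrm x = 0 -> x = 0.
Proof. by move=> x0; apply: normr0_eq0; rewrite nrmE x0. Qed.

Lemma ler_nrm x e : 0 <= e -> (nrm x <= e) = (nrm x ^+ 2 <= e ^+ 2).
Proof. by move=> e0; rewrite ler_pXn2r// nnegrE nrm_ge0. Qed.

Lemma rin_le x y : `|rin x y| <= nrm x * nrm y.
Proof.
rewrite -(@ler_pXn2r _ 2)// ?nnegrE ?mulr_ge0 ?nrm_ge0//.
by rewrite -normrX ger0_norm ?sqr_ge0// exprMn -!rinxx rform_CauchySchwarz.
Qed.

Lemma cvg_nrmP (u : nat -> H) x :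
  (u @ \oo --> x) <-> (forall e, 0 < e -> \forall n \near \oo, nrm (u n - x) < e).
Proof.
split=> [/cvgrPdist_lt ux e e0|ux].
  have := ux e%:C; rewrite ltcR => /(_ e0); apply: filterS => n.
  by rewrite nrmE ltcR nrmB.
apply/cvgrPdist_lt => -[e e']; rewrite ltcE /= => /andP[/eqP -> e0].
by have := ux e e0; apply: filterS => n; rewrite nrmB nrmE ltcR.
Qed.

(** Real parts suffice: testing against ['i%C *: y] yields the imaginary part of testing against
    [y]. *)
Lemma weak_cvgP (u : nat -> H) x :
  weak_cvg u x <->
  forall y e, 0 < e -> \forall n \near \oo, `|rin (u n - x) y| < e.
Proof.
have Re_B (z w : R[i]) : complex.Re (z - w) = complex.Re z - complex.Re w.
  by case: z w => [? ?] [? ?].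
have conj_i : Num.conj ('i%C : R[i]) = - 'i%C by rewrite complexiE conjCi.
split=> [ux y e e0|ux y].
  have /cvgrPdist_lt/(_ e%:C) := ux y; rewrite ltcR => /(_ e0).
  apply: filterS => n; rewrite distrC -linearBl => h.
  by rewrite rinE -ltcR (le_lt_trans (normc_ge_Re _)).
apply/cvgrPdist_lt => -[e e']; rewrite ltcE /= => /andP[/eqP -> {e'} e0].
have e2 : 0 < e / 2 by rewrite divr_gt0.
have := ux ('i%C *: y) _ e2; have := ux y _ e2.
apply: filterS2 => n; rewrite !rinE distrC -linearBl /= linearZr_LR /= conj_i.
case: (inner _ _) => p q /=; rewrite !mulN1r oppr0 !mul0r sub0r opprK => h1 h2.
rewrite normc_def /= ltcR.
apply: (@le_lt_trans _ _ (`|p| + `|q|)); last by lra.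
rewrite -(@ler_pXn2r _ 2)// ?nnegrE ?addr_ge0 ?sqrtr_ge0//.
rewrite sqr_sqrtr ?addr_ge0 ?sqr_ge0//.
rewrite -[p ^+ 2]real_normK ?num_real// -[q ^+ 2]real_normK ?num_real//.
by have := normr_ge0 p; have := normr_ge0 q; nra.
Qed.

(** The Cauchy criterion as the parallelogram law provides it for a minimizing sequence, [d n]
    measuring the excess over the infimum. *)
Lemma complete_nrm (u : nat -> H) (c : R) (d : nat -> R) : 0 < c ->
  (forall e, 0 < e -> \forall n \near \oo, d n < e) ->
  (forall m n, c * nrm (u m - u n) ^+ 2 <= d m + d n) ->
  exists l, forall e, 0 < e -> \forall n \near \oo, nrm (u n - l) < e.
Proof.
move=> c0 d0 ud.
suff /cvg_ex[l /cvg_nrmP ul] : cvg (u @ \oo) by exists l.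
apply/cauchy_cvgP/cauchyP => -[e e']; rewrite ltcE /= => /andP[/eqP -> {e'} e0].
have ce : 0 < c * e ^+ 2 / 2 by rewrite divr_gt0// mulr_gt0// exprn_gt0.
have [N _ dN] := d0 _ ce.
exists (u N); exists N => // n Nn; rewrite /= -ball_normE /= nrmE ltcR.
rewrite -(@ltr_pXn2r _ 2)// ?nnegrE ?nrm_ge0 ?(ltW e0)//.
rewrite -(ltr_pM2l c0); apply: (le_lt_trans (ud _ _)).
by have := dN _ Nn; have := dN _ (leqnn N) => /=; lra.
Qed.

End RealInner.

(** * Hilbert spaces *)

Lemma not_near_infty (P : nat -> Prop) : ~ (\forall n \near \oo, P n) ->
  forall N, exists2 n, (N <= n)%N & ~ P n.
Proof.
move=> nP N; apply: contrapT => h; apply: nP; exists N => // n /= Nn.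
by apply: contrapT => Pn; apply: h; exists n.
Qed.

Section HilbertSpace.
Variables (R : realType) (H : hilbertType R).
Implicit Types (x y z : H) (t e : R) (b : realForm H).

Definition norm_cvg (u : nat -> H) x :=
  forall e, 0 < e -> \forall n \near \oo, nrm (u n - x) < e.

Lemma rform_bounded b C : (forall x, b x x <= C * nrm x ^+ 2) ->
  forall v, exists2 K, 0 < K & forall x, `|b v x| <= K * nrm x.
Proof.
move=> bC v; pose K2 := b v v * `|C|.
have K0 : 0 <= K2 by rewrite mulr_ge0 ?rform_ge0.
(* Cauchy-Schwarz gives the bound [Num.sqrt K2]; the 1 makes it positive, so that one may divide by
   it. *)
exists (1 + Num.sqrt K2) => [|x]; first by rewrite ltr_pwDl// sqrtr_ge0.
apply: (@le_trans _ _ (Num.sqrt K2 * nrm x)); last first.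
  by rewrite ler_wpM2r ?nrm_ge0// lerDr.
rewrite -(@ler_pXn2r _ 2)// ?nnegrE ?mulr_ge0 ?nrm_ge0 ?sqrtr_ge0//.
rewrite -normrX ger0_norm ?sqr_ge0// exprMn sqr_sqrtr//.
apply: (le_trans (rform_CauchySchwarz _ _ _)).
rewrite -mulrA ler_wpM2l ?rform_ge0//; apply: (le_trans (bC x)).
by rewrite ler_wpM2r ?sqr_ge0// ler_norm.
Qed.

(** Expand [b] at [x]: the linear term tends to 0 and the quadratic one is nonnegative. *)
Lemma rform_lsc b C (u : nat -> H) x : (forall y, b y y <= C * nrm y ^+ 2) ->
  norm_cvg u x -> forall e, 0 < e -> \forall n \near \oo, b x x - e < b (u n) (u n).
Proof.
move=> bC ux e e0; have [K K0 bK] := rform_bounded bC x.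
have := ux (e / (2 * K)); rewrite divr_gt0 ?mulr_gt0// => /(_ isT).
apply: filterS => n; rewrite ltr_pdivlMr ?mulr_gt0// => h.
have := rformDD b x (u n - x); rewrite addrC subrK => ->.
have := rform_ge0 b (u n - x); have := bK (u n - x).
by rewrite ler_norml => /andP[]; lra.
Qed.

Record closed_real_subspace (W : set H) : Prop := {
  crs0 : W 0;
  crsD : forall x y, W x -> W y -> W (x + y);
  crsZ : forall t x, W x -> W (t%:C *: x);
  crs_closed : forall (u : nat -> H) x, (forall n, W (u n)) -> norm_cvg u x -> W x }.

Record bounded_functional (l : H -> R) : Prop := {
  bfD : forall x y, l (x + y) = l x + l y;
  bfZ : forall t x, l (t%:C *: x) = t * l x;
  bfB : exists2 K, 0 < K & forall x, `|l x| <= K * nrm x }.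

Lemma rin_bounded_functional y : bounded_functional (rin H y).
Proof.
split=> [x z|t x|]; [exact: rformDr|exact: rformZr|].
exists (1 + nrm y) => [|x]; first by rewrite ltr_pwDl// nrm_ge0.
by rewrite (le_trans (rin_le _ _))// ler_wpM2r ?nrm_ge0// lerDr.
Qed.

(* The representing vector minimizes [b v v - 2 l v] over [W]. *)
Lemma Riesz b c C (W : set H) (l : H -> R) :
  0 < c -> (forall x, c * nrm x ^+ 2 <= b x x) ->
  (forall x, b x x <= C * nrm x ^+ 2) ->
  closed_real_subspace W -> bounded_functional l ->
  exists2 u, W u & forall v, W v -> b u v = l v.
Proof.
move=> c0 cb bC [W0 WD WZ Wcl] [lD lZ [K K0 lK]].
pose G v := b v v - 2 * l v.
(* Complete the square in [c r^2 - 2 K r] with [r = nrm v]. *)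
have Glb v : - (K ^+ 2 / c) <= G v.
  have := cb v; have := lK v; rewrite ler_norml => /andP[_ h1] h2.
  have h3 : 0 <= (c * nrm v - K) ^+ 2 / c by rewrite divr_ge0 ?sqr_ge0 ?ltW.
  have h4 : (c * nrm v - K) ^+ 2 / c = c * nrm v ^+ 2 - 2 * K * nrm v + K ^+ 2 / c.
    by field; rewrite gt_eqF.
  by rewrite /G; lra.
have GW : has_inf (G @` W).
  split; first by exists (G 0), 0.
  by exists (- (K ^+ 2 / c)) => _ [v _ <-].
pose m := inf (G @` W).
have mG v : W v -> m <= G v by move=> Wv; apply: ge_inf; [case: GW|exists v].
have /choice[u Wu] : forall n, exists v, W v /\ G v < m + n.+1%:R^-1.
  move=> n; have := inf_adherent _ GW; move=> /(_ n.+1%:R^-1); rewrite invr_gt0 ltr0n.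
  by move=> /(_ isT)[_ [v Wv <-] Gv]; exists v.
have d0 e : 0 < e -> \forall n \near \oo, 2 * (G (u n) - m) < e.
  move=> e0; have e2 : 0 < e / 2 by rewrite divr_gt0.
  have := near_infty_natSinv_lt (PosNum e2); apply: filterS => n /= h.
  by have [_] := Wu n; move: h; set s := _^-1; lra.
have [x ux] : exists x, norm_cvg u x.
  apply: (complete_nrm c0 d0) => n k; apply: (le_trans (cb _)).
  (* Parallelogram law: since [m <= G h] at the midpoint, [b] at [u n - u k] is at most
     [2 (G (u n) - m) + 2 (G (u k) - m)]. *)
  pose h := (2^-1)%:C *: (u n + u k).
  have Wh : W h by apply/WZ/WD; [case: (Wu n)|case: (Wu k)].
  have := mG _ Wh; rewrite /G /h lZ lD !rformE (rformC b (u k) (u n)); lra.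
have Wx : W x by apply: Wcl ux => n; case: (Wu n).
have Gx : G x <= m.
  apply/ler_addgt0Pr => e e0.
  have e4 : 0 < e / 4 by rewrite divr_gt0.
  have eK : 0 < e / (8 * K) by rewrite divr_gt0 ?mulr_gt0.
  have [n [h1 h2 h3]] : exists n, [/\ b x x - e / 4 < b (u n) (u n),
      nrm (u n - x) < e / (8 * K) & G (u n) < m + e / 4].
    near \oo => n; exists n; split.
    - by near: n; exact: rform_lsc bC ux _ e4.
    - by near: n; exact: ux.
    - have [_ /lt_le_trans] := Wu n; apply; rewrite lerD2l ltW//.
      by near: n; exact: near_infty_natSinv_lt (PosNum e4).
  move: h2; rewrite ltr_pdivlMr ?mulr_gt0// => h2.
  have := lK (u n - x); rewrite ler_norml => /andP[_].
  have -> : u n - x = u n + (-1 : R)%:C *: x by rewrite rmorphN1 scaleN1r.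
  rewrite lD lZ rmorphN1 scaleN1r; move: h3; rewrite /G; lra.
exists x => // v Wv.
pose D := b x v - l v; suff : D = 0 by move=> /eqP; rewrite subr_eq0 => /eqP.
have B0 : 0 < b v v + 1 by rewrite ltr_wpDl ?rform_ge0.
(* The step [- D / b v v] would be optimal along [v]; the added 1 avoids a zero denominator, and [G]
   still decreases strictly unless [D = 0]. *)
have := mG (x + (- D / (b v v + 1))%:C *: v) (WD _ _ Wx (WZ _ _ Wv)).
move/(le_trans Gx); rewrite /G rformDD !rformE lD lZ -subr_ge0.
set s := _ - _; have -> : s = - (D ^+ 2 * (b v v + 2)) / (b v v + 1) ^+ 2.
  by rewrite /s /D; field; rewrite gt_eqF.
rewrite mulNr oppr_ge0 pmulr_lle0 ?invr_gt0 ?exprn_gt0//.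
rewrite pmulr_lle0; last by have := rform_ge0 b v; lra.
by move=> D0; apply/eqP; rewrite -sqrf_eq0 eq_le D0 sqr_ge0.
Unshelve. all: by end_near. Qed.

(* Gliding hump: each step moves [Y k] by [3 ^- k] in the direction of a very
   long [u (phi k)], which later, shorter steps cannot compensate. *)
Lemma uniform_boundedness (u : nat -> H) :
  (forall y, exists M, \forall n \near \oo, `|rin H (u n) y| <= M) ->
  exists M, \forall n \near \oo, nrm (u n) <= M.
Proof.
move=> ub; apply: contrapT => nub.
pose r k : R := 3^-1 ^+ k.
have r0 k : 0 < r k by rewrite exprn_gt0.
have rS k : r k.+1 = r k / 3 by rewrite /r exprSr.
have /choice[phi phiP] : forall k, exists n, (k <= n)%N /\ 2 * k%:R / r k < nrm (u n).
  move=> k; have /not_near_infty/(_ k)[n kn /negP] :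
      ~ \forall n \near \oo, nrm (u n) <= 2 * k%:R / r k.
    by move=> h; apply: nub; exists (2 * k%:R / r k).
  by rewrite -ltNge; exists n.
pose X k := u (phi k).
have X0 k : 0 < nrm (X k).
  apply: le_lt_trans (phiP k).2.
  by rewrite divr_ge0 ?mulr_ge0 ?ler0n// ltW.
have /choice[f fP] : forall ky : nat * H, exists z,
    nrm (z - ky.2) <= r ky.1 /\ r ky.1 * nrm (X ky.1) <= `|rin H (X ky.1) z|.
  move=> [k y] /=.
  (* With this sign the increment reinforces [rin H (X k) y] instead of cancelling it. *)
  pose s : R := if 0 <= rin H (X k) y then 1 else -1.
  exists (y + (s * (r k / nrm (X k)))%:C *: X k); split.
    rewrite addrC addKr nrmZ normrM /s.
    have -> : `|if 0 <= rin H (X k) y then 1 else - 1| = 1 :> R.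
      by case: ifP => _; rewrite ?normrN normr1.
    by rewrite mul1r gtr0_norm ?divr_gt0// divfK// gt_eqF.
  rewrite !rformE rinxx expr2 -!mulrA mulKf ?gt_eqF//.
  have p0 : 0 < r k * nrm (X k) by rewrite mulr_gt0.
  rewrite /s; case: (lerP 0 (rin H (X k) y)) => h.
    by rewrite mul1r ger0_norm ?lerDr//; lra.
  by rewrite mulN1r ltr0_norm; lra.
pose Y := fix Y k := if k is k'.+1 then f (k', Y k') else 0 : H.
have YS k : nrm (Y k.+1 - Y k) <= r k by have [] := fP (k, Y k).
have YX k : r k * nrm (X k) <= `|rin H (X k) (Y k.+1)| by have [] := fP (k, Y k).
(* A geometric sum of ratio 1/3, whence the factor [3 / 2]. *)
have Yn n p : nrm (Y (n + p)%N - Y n) <= 3 / 2 * (r n - r (n + p)%N).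
  elim: p => [|p IH]; first by rewrite addn0 !subrr nrm0 mulr0.
  rewrite addnS; have := nrmD (Y (n + p).+1 - Y (n + p)%N) (Y (n + p)%N - Y n).
  by rewrite addrA subrK => /le_trans; apply; have := YS (n + p)%N; rewrite rS; lra.
have Ym n m : (n <= m)%N -> nrm (Y m - Y n) <= 3 / 2 * r n.
  move=> nm; rewrite -(subnKC nm); apply: (le_trans (Yn _ _)).
  by have := r0 (n + (m - n))%N; lra.
have [y Yy] : exists y, norm_cvg Y y.
  apply: (@complete_nrm _ _ _ 1 (fun n => (3 / 2 * r n) ^+ 2)) => // [e e0|m n].
    have : (fun n => geometric (9 / 4 : R) (9^-1) n) @ \oo --> (0 : R).
      apply: cvg_geometric; rewrite ger0_norm ?invr_ge0//; lra.
    move=> /cvgrPdist_lt/(_ _ e0); apply: filterS => n.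
    rewrite sub0r normrN /= ger0_norm ?mulr_ge0 ?exprn_ge0//.
    suff -> : (3 / 2 * r n) ^+ 2 = 9 / 4 * 9^-1 ^+ n by [].
    rewrite /r exprMn; congr (_ * _); first by field.
    by rewrite -exprM mulnC exprM; congr (_ ^+ _); field.
  rewrite mul1r; case: (leqP n m) => nm.
    rewrite (@le_trans _ _ ((3 / 2 * r n) ^+ 2))// ?lerDr ?sqr_ge0//.
    by rewrite -ler_nrm ?Ym// mulr_ge0 ?ltW.
  rewrite nrmB (@le_trans _ _ ((3 / 2 * r m) ^+ 2))// ?lerDl ?sqr_ge0//.
  by rewrite -ler_nrm ?Ym 1?ltnW// mulr_ge0 ?ltW.
(* All later steps together undo at most half of what step [k] gained. *)
have yY k : nrm (y - Y k.+1) <= r k / 2.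
  apply/ler_addgt0Pr => e e0.
  have [n kn Yn'] : exists2 n, (k < n)%N & nrm (Y n - y) < e.
    near \oo => n; exists n; near: n; first exact: nbhs_infty_gt.
    exact: Yy.
  have := Ym _ _ kn; rewrite rS.
  have := nrmD (y - Y n) (Y n - Y k.+1); rewrite addrA subrK (nrmB y); lra.
have [M /= [N _ MN]] := ub y.
(* For this [k], [|rin H (X k) y| >= r k * nrm (X k) / 2 > k > M], while [phi k >= N]. *)
pose k := (maxn N (Num.truncn `|M|).+1)%N.
have := MN (phi k); rewrite /= => /(_ (leq_trans (leq_maxl _ _) (phiP k).1)).
rewrite -/(X k); apply/negP; rewrite -ltNge.
have kM : M < k%:R.
  rewrite (le_lt_trans (ler_norm M))// (lt_le_trans (truncnS_gt _))// ler_nat.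
  exact: leq_maxr.
have : 2 * k%:R < nrm (X k) * r k by rewrite -ltr_pdivrMr// (phiP k).2.
have := YX k; have := rin_le (X k) (y - Y k.+1).
have : nrm (X k) * nrm (y - Y k.+1) <= nrm (X k) * (r k / 2).
  by rewrite ler_pM2l// yY.
have := ler_normD (rin H (X k) y) (- rin H (X k) (y - Y k.+1)).
rewrite -rformNr opprB -rformDr addrC subrK -[in X in _ <= _ + X]opprB rformNr normrN.
lra.
Unshelve. all: by end_near. Qed.

Lemma weak_cvg_bounded (u : nat -> H) x : weak_cvg u x ->
  exists M, \forall n \near \oo, nrm (u n) <= M.
Proof.
move=> /weak_cvgP ux; apply: uniform_boundedness => y.
exists (`|rin H x y| + 1); have := ux y 1 ltr01; apply: filterS => n.
rewrite rformDl rformNl => h.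
have := ler_normD (rin H x y) (rin H (u n) y - rin H x y).
by rewrite addrC subrK; lra.
Qed.

End HilbertSpace.

(** * Weak sequential compactness *)

Section WeakCompactness.
Variables (R : realType) (H : hilbertType R).
Implicit Types (x y z : H) (e : R).

(** The limit is the supremum of the levels [t] with [t <= f n] for [U]-most [n]; for a level above
    it, the ultrafilter contains the complementary set. *)
Lemma ultra_bounded_lim (U : set_system nat) (f : nat -> R) K : UltraFilter U ->
  (forall n, `|f n| <= K) ->
  exists p, forall e, 0 < e -> \forall n \near U, `|f n - p| < e.
Proof.
move=> UU fK; have fK' n : - K <= f n <= K by rewrite -ler_norml.
pose E := [set t | U [set n | t <= f n]].
have Esup : has_sup E.
  split.
    by exists (- K); apply: filterE => n; case/andP: (fK' n).
  by exists K => t /filter_ex[n /= tn]; case/andP: (fK' n) => _; exact: le_trans.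
exists (sup E) => e e0.
have [t Et et] := sup_adherent e0 Esup.
have [|h] := @in_ultra_setVsetC _ U [set n | sup E + e / 2 <= f n] UU.
  move=> /(ub_le_sup Esup.2); rewrite gerDl => h.
  by have := divr_gt0 e0 (ltr0n R 2); rewrite ltNge h.
apply: filterS2 Et h => n /= tn /negP; rewrite -ltNge => nt.
by rewrite ltr_norml; apply/andP; split; lra.
Qed.

(** The limits of [rin H (u n) y] along [U] are linear and bounded in [y], so Riesz represents them
    by [z]. *)
Lemma ultra_weak_lim (U : set_system nat) (u : nat -> H) M : UltraFilter U ->
  (forall n, nrm (u n) <= M) ->
  exists z, forall y e, 0 < e -> \forall n \near U, `|rin H (u n - z) y| < e.
Proof.
move=> UU uM.
have M0 : 0 <= M by apply: le_trans (uM 0%N); exact: nrm_ge0.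
have bnd y n : `|rin H (u n) y| <= M * nrm y.
  by rewrite (le_trans (rin_le _ _))// ler_wpM2r ?nrm_ge0.
have /choice[l lP] : forall y, exists p, forall e, 0 < e ->
    \forall n \near U, `|rin H (u n) y - p| < e.
  by move=> y; exact: ultra_bounded_lim (bnd y).
have uniq p q (f : nat -> R) : (forall e, 0 < e -> \forall n \near U, `|f n - p| < e) ->
    (forall e, 0 < e -> \forall n \near U, `|f n - q| < e) -> p = q.
  move=> fp fq; apply/eqP; rewrite -subr_eq0 -normr_le0; apply/ler_addgt0Pr => e e0.
  have e2 : 0 < e / 2 by rewrite divr_gt0.
  have [n [h1 h2]] := filter_ex (filterI (fp _ e2) (fq _ e2)).
  by rewrite (distrC (f n)) in h1; have := ler_distD (f n) p q; lra.
have [z _ zl] : exists2 z, setT z & forall y, setT y -> rin H z y = l y.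
  apply: (@Riesz _ _ _ 1 1) => //; try by move=> x; rewrite rinxx mul1r.
  split.
  - move=> x y; apply: uniq (lP (x + y)) _ => e e0.
    have e2 : 0 < e / 2 by rewrite divr_gt0.
    apply: filterS2 (lP x _ e2) (lP y _ e2) => n h1 h2.
    rewrite rformDr opprD addrACA.
    by have := ler_normD (rin H (u n) x - l x) (rin H (u n) y - l y); lra.
  - move=> t x; apply: uniq (lP (t%:C *: x)) _ => e e0.
    have t0 : 0 < `|t| + 1 by rewrite ltr_wpDl.
    have e2 : 0 < e / (`|t| + 1) by rewrite divr_gt0.
    apply: filterS (lP x _ e2) => n h1.
    rewrite rformZr -mulrBr normrM; rewrite ltr_pdivlMr// in h1.
    by rewrite (le_lt_trans _ h1)// mulrC ler_wpM2l// lerDl.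
  exists (M + 1) => [|y]; first by rewrite ltr_wpDl.
  apply/ler_addgt0Pr => e e0; have [n h] := filter_ex (lP y _ e0).
  have := bnd y n; rewrite distrC in h; have := nrm_ge0 y.
  by have := ler_normD (rin H (u n) y) (l y - rin H (u n) y); rewrite addrC subrK; lra.
exists z => y e e0; apply: filterS (lP y _ e0) => n.
by rewrite rformDl rformNl zl.
Qed.

(** [phi] need not be monotone: a value beyond all [phi k] with [k < N] is attained only at indices
    [k >= N]. *)
Lemma near_range (phi : nat -> nat) (P : nat -> Prop) :
  (\forall k \near \oo, P (phi k)) -> \forall n \near \oo, range phi n -> P n.
Proof.
move=> [N _ NP]; exists (\max_(k < N) phi k).+1 => // n /= hn [k _ kn].
rewrite -kn; apply: NP; rewrite /= leqNgt; apply/negP => kN.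
by move: hn; rewrite -kn ltnNge (leq_bigmax (Ordinal kN)).
Qed.

(* An ultrafilter provides a weak limit [z]; the subsequence [phi] only has to
   test it against [z] and the [u m]: the vectors passing the test form a closed
   subspace, and [u n - z] is orthogonal to its orthogonal complement. *)
Lemma weak_compactness (u : nat -> H) M (S : set nat) :
  (forall n, nrm (u n) <= M) -> (forall N, exists2 n, (N <= n)%N & S n) ->
  exists T z, [/\ T `<=` S, forall N, exists2 n, (N <= n)%N & T n &
    forall y e, 0 < e -> \forall n \near \oo, T n -> `|rin H (u n - z) y| < e].
Proof.
move=> uM Sinf.
have FF : ProperFilter (within S \oo).
  apply: Build_ProperFilter_ex => A [N _ NA].
  by have [n Nn Sn] := Sinf N; exists n; exact: NA.
have [U [UU FU]] := ultraFilterLemma FF.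
have [z Uz] := ultra_weak_lim UU uM.
have Useg k e : 0 < e -> \forall n \near U,
    forall m, (m < k)%N -> `|rin H (u n - z) (u m)| < e.
  move=> e0; elim: k => [|k IH]; first exact: filterE.
  apply: filterS2 IH (Uz (u k) _ e0) => n h1 h2 m.
  by rewrite ltnS leq_eqVlt => /orP[/eqP ->//|]; exact: h1.
(* Diagonal choice: index [k] passes the tests against [z] and the first [k] vectors, up to
   [1 / (k + 1)]. *)
have /choice[phi phiP] : forall k, exists n, [/\ (k <= n)%N, S n,
    `|rin H (u n - z) z| < k.+1%:R^-1 &
    forall m, (m < k)%N -> `|rin H (u n - z) (u m)| < k.+1%:R^-1].
  move=> k; have k0 : 0 < k.+1%:R^-1 :> R by rewrite invr_gt0 ltr0n.
  apply: (@filter_ex _ U); near=> n; split; near: n.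
  - by apply: FU; exists k.
  - by apply: FU; exists 0%N.
  - exact: Uz.
  - exact: Useg.
have k_small e : 0 < e -> \forall k \near \oo, k.+1%:R^-1 < e.
  by move=> e0; exact: near_infty_natSinv_lt (PosNum e0).
pose W := [set y | forall e, 0 < e ->
  \forall k \near \oo, `|rin H (u (phi k) - z) y| < e].
have Wz : W z.
  move=> e e0; apply: filterS (k_small _ e0) => k; apply: lt_trans.
  by have [] := phiP k.
have Wu m : W (u m).
  move=> e e0; apply: filterS2 (nbhs_infty_gt m) (k_small _ e0) => k mk.
  by apply: lt_trans; have [_ _ _] := phiP k; exact.
have bnd n y : `|rin H (u n - z) y| <= (M + nrm z) * nrm y.
  rewrite (le_trans (rin_le _ _))// ler_wpM2r ?nrm_ge0//.
  by rewrite (le_trans (nrmD _ _))// nrmN lerD2r.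
have M0 : 0 < M + nrm z + 1.
  by rewrite ltr_wpDl// addr_ge0 ?nrm_ge0// (le_trans _ (uM 0%N)) ?nrm_ge0.
have Wcl : closed_real_subspace W.
  split.
  - by move=> e e0; apply: filterE => k; rewrite rformC rform0l normr0.
  - move=> x y Wx Wy e e0; have e2 : 0 < e / 2 by rewrite divr_gt0.
    apply: filterS2 (Wx _ e2) (Wy _ e2) => k h1 h2; rewrite rformDr.
    by have := ler_normD (rin H (u (phi k) - z) x) (rin H (u (phi k) - z) y); lra.
  - move=> t x Wx e e0; have t0 : 0 < `|t| + 1 by rewrite ltr_wpDl.
    have e2 : 0 < e / (`|t| + 1) by rewrite divr_gt0.
    apply: filterS (Wx _ e2) => k; rewrite ltr_pdivlMr// => h1.
    by rewrite rformZr normrM (le_lt_trans _ h1)// mulrC ler_wpM2l// lerDl.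
  - move=> v x Wv vx e e0.
    have e2 : 0 < e / 2 by rewrite divr_gt0.
    have eM : 0 < e / 2 / (M + nrm z + 1) by rewrite divr_gt0.
    have [m] := filter_ex (vx _ eM); rewrite ltr_pdivlMr// => vm.
    apply: filterS (Wv m _ e2) => k h1.
    have := ler_normD (rin H (u (phi k) - z) (v m)) (rin H (u (phi k) - z) (x - v m)).
    rewrite -rformDr (addrC (v m)) subrK; have := bnd (phi k) (x - v m); rewrite nrmB.
    have := nrm_ge0 (v m - x); lra.
exists (range phi), z; split.
- by move=> _ [k _ <-]; have [] := phiP k.
- by move=> N; exists (phi N); [have [] := phiP N|exists N].
move=> y e e0; apply: near_range.
(* [p] is the orthogonal projection of [y] on [W]; since [u (phi k) - z] lies in [W], testing
   against [p] is testing against [y]. *)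
have [p Wp py] : exists2 p, W p & forall v, W v -> rin H p v = rin H y v.
  apply: (@Riesz _ _ _ 1 1) => //; try by move=> x; rewrite rinxx mul1r.
  exact: rin_bounded_functional.
apply: filterS (Wp _ e0) => k; rewrite rformC py ?(rformC _ y)//.
rewrite -scaleN1r -(rmorphN1 (real_complex R)).
by apply: (crsD Wcl) => //; exact: (crsZ Wcl).
Unshelve. all: by end_near. Qed.

End WeakCompactness.

(** * Sequences and inferior limits *)

(** Diagonal selection: at [n], take a [v] meeting the smallest attainable tolerance [1 / (k + 1)]
    with [k <= n]. The cap on [k] guarantees that a smallest one exists. *)
Lemma near_selection (R : realType) (V_ : nat -> pointedType)
    (E : forall n, V_ n -> R) :
  (forall e, 0 < e -> \forall n \near \oo, exists v, E n v < e) ->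
  exists u : forall n, V_ n, forall e, 0 < e -> \forall n \near \oo, E n (u n) < e.
Proof.
move=> hE.
pose P n k := `[< exists v, E n v < k.+1%:R^-1 >].
pose best n (v : V_ n) := forall k, (k <= n)%N -> P n k -> E n v < k.+1%:R^-1.
have ex_best n : exists v, @best n v.
  have [[k0 k0P]|nP] := pselect (exists k, (k <= n)%N && P n k); last first.
    by exists point => k kn Pk; case: nP; exists k; rewrite kn.
  have exP : exists k, (k <= n)%N && P n k by exists k0.
  have bP k : (k <= n)%N && P n k -> (k <= n)%N by case/andP.
  case: (ex_maxnP exP bP) => k /andP[kn /asboolP[v vk]] kmax.
  exists v => i ni Pi; apply: (lt_le_trans vk).
  by rewrite lef_pV2 ?posrE ?ltr0n// ler_nat ltnS; apply: kmax; rewrite ni.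
exists (fun n => projT1 (cid (ex_best n))) => e e0.
have [k _ ke] := near_infty_natSinv_lt (PosNum e0).
have ke' : k.+1%:R^-1 < e by apply: ke => /=.
have k0 : 0 < k.+1%:R^-1 :> R by rewrite invr_gt0 ltr0n.
apply: filterS2 (nbhs_infty_ge k) (hE _ k0) => n kn Pk.
by apply: lt_trans ke'; case: cid => v /= /(_ k kn); apply; apply/asboolP.
Qed.

Section ExtendedLimits.
Variables (R : realType) (g : nat -> R) (c : R).
Local Notation f := (fun n => (g n)%:E).

Lemma limn_einf_le : (forall N, exists2 n, (N <= n)%N & g n <= c) ->
  (limn_einf f <= c%:E)%E.
Proof.
move=> h; rewrite /limn_einf -/(limf_einf f \oo) limf_einfE.
apply: ge_ereal_sup => _ [A [N _ NA] <-]; have [n Nn gn] := h N.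
by apply: ge_ereal_inf; exists (g n)%:E; [exists n => //; exact: NA|rewrite lee_fin].
Qed.

Lemma le_limn_einf : (forall e, 0 < e -> \forall n \near \oo, c - e <= g n) ->
  (c%:E <= limn_einf f)%E.
Proof.
move=> h; rewrite /limn_einf -/(limf_einf f \oo) limf_einfE.
apply/lee_subgt0Pr => e e0; apply: le_ereal_sup_tmp.
exists (ereal_inf (f @` [set n | c - e <= g n])).
  by exists [set n | c - e <= g n] => //; exact: h.
by apply: le_ereal_inf_tmp => _ [n /= gn <-]; rewrite -EFinB lee_fin.
Qed.

Lemma limn_esup_le : (forall e, 0 < e -> \forall n \near \oo, g n <= c + e) ->
  (limn_esup f <= c%:E)%E.
Proof.
move=> h; rewrite /limn_esup limf_esupE.
apply/lee_addgt0Pr => e e0; apply: ge_ereal_inf.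
exists (ereal_sup (f @` [set n | g n <= c + e])).
  by exists [set n | g n <= c + e] => //; exact: h.
by apply: ge_ereal_sup => _ [n /= gn <-]; rewrite -EFinD lee_fin.
Qed.

Lemma limn_esup_lt : (limn_esup f <= c%:E)%E ->
  forall e, 0 < e -> \forall n \near \oo, g n < c + e.
Proof.
rewrite /limn_esup limf_esupE => h e e0.
have : (ereal_inf [set ereal_sup (f @` V) | V in \oo] < (c + e)%:E)%E.
  by rewrite (le_lt_trans h)// lte_fin ltrDl.
move=> /ereal_inf_lt[_ [A hA <-] Ae]; apply: filterS hA => n An.
by rewrite -lte_fin; apply: le_lt_trans Ae; apply: ereal_sup_ubound; exists n.
Qed.

End ExtendedLimits.

(** * Minimizers of the energy *)

Section Prox.
Variables (R : realType) (V H : hilbertType R).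
Variables (j : {linear V -> H}) (a : realForm V).
Implicit Types (lam : R) (x : H) (u v w : V).

(** What ellipticity and positivity give together: [coercive_ge] holds for every [lam > 0], however
    large [omega] is. *)
Record coercive : Prop := {
  coercive_j : exists2 K, 0 < K & forall u, nrm (j u) <= K * nrm u;
  coercive_le : exists C, forall u, a u u <= C * nrm u ^+ 2;
  coercive_ge : forall lam, 0 < lam ->
    exists2 c, 0 < c & forall u, c * nrm u ^+ 2 <= a u u + lam * nrm (j u) ^+ 2 }.

Definition energy lam x v := a v v + lam * nrm (j v - x) ^+ 2.

(* The Euler equation of the minimization of [energy lam x]. *)
Definition prox lam x w := forall v, a w v = lam * rin H (x - j w) (j v).

Lemma prox_exists lam x : coercive -> 0 < lam -> exists w, prox lam x w.
Proof.
move=> [[K K0 jK] [C aC] /(_ lam)] + lam0 => /(_ lam0)[c c0 ca].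
pose b := pullback_sum j a (rin H) (ltW lam0).
have bE u v : b u v = a u v + lam * rin H (j u) (j v) by [].
have jK2 u : nrm (j u) ^+ 2 <= (K * nrm u) ^+ 2.
  by rewrite -ler_nrm// mulr_ge0 ?nrm_ge0// ltW.
have [w _ wP] : exists2 w, setT w & forall v, setT v -> b w v = lam * rin H x (j v).
  apply: (@Riesz _ _ b c (C + lam * K ^+ 2)) => //.
  - by move=> u; rewrite bE rinxx.
  - move=> u; rewrite bE rinxx mulrDl lerD// -mulrA -exprMn.
    by rewrite ler_wpM2l// ltW.
  - split=> [u v|t u|].
    + by rewrite linearD rformDr mulrDr.
    + by rewrite linearZ /= rformZr mulrCA.
    + exists (lam * (nrm x + 1) * K) => [|u].
        by rewrite !mulr_gt0// ltr_wpDl// nrm_ge0.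
      rewrite normrM gtr0_norm// -!mulrA ler_pM2l//.
      apply: (le_trans (rin_le _ _)).
      by rewrite ler_pM ?nrm_ge0// lerDl.
exists w => v; rewrite rformDl rformNl mulrBr; apply/eqP.
by rewrite -subr_eq0 opprB addrA subr_eq0 -bE wP.
Qed.

(** Exact second-order expansion at [w]: the Euler equation removes the linear term. The
    substitutions [v = w + h] and [x = s + j w] leave an identity for [ring]. *)
Lemma prox_energy lam x w v : prox lam x w ->
  energy lam x v = energy lam x w + a (v - w) (v - w) + lam * nrm (j v - j w) ^+ 2.
Proof.
have [h ->] : exists h, v = w + h by exists (v - w); rewrite addrC subrK.
have -> : w + h - w = h by rewrite addrC addKr.
rewrite linearD (_ : j w + j h - j w = j h); last by rewrite addrC addKr.
have [s ->] : exists s, x = s + j w by exists (x - j w); rewrite subrK.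
rewrite /prox addrK => wP; rewrite /energy -!rinxx linearD.
have -> : j w + j h - (s + j w) = j h - s.
  by rewrite (addrC (j w)) opprD addrACA subrr addr0.
have -> : j w - (s + j w) = - s by rewrite opprD addrCA subrr addr0.
rewrite rformDD (wP h) !rformE (rformC _ s (j h)). ring.
Qed.

Lemma prox_energy_min lam x w v : 0 <= lam -> prox lam x w ->
  energy lam x w <= energy lam x v.
Proof.
move=> lam0 wP; rewrite (prox_energy v wP) -addrA lerDl addr_ge0 ?rform_ge0//.
by rewrite mulr_ge0 ?sqr_ge0.
Qed.

(** The Euler equation tested with [w]. The minimal energy is thus affine in [j w], so it converges
    as soon as the [j w] do. *)
Lemma prox_energyE lam x w : prox lam x w -> energy lam x w = lam * rin H (x - j w) x.
Proof.
move=> wP; rewrite /energy wP nrmB -rinxx -mulrDr -rformDr.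
by rewrite (addrC (j w)) subrK.
Qed.

(* Duality: a quadratic form lies above its tangents. *)
Lemma prox_tangent lam x w v : prox lam x w ->
  energy lam x w - lam * nrm (x - j w) ^+ 2
    + 2 * lam * rin H (x - j w) (j v - j w) <= a v v.
Proof.
move=> wP; rewrite /energy nrmB addrK.
have := rformDD a w (v - w); rewrite (addrC w) subrK => ->.
by rewrite (wP (v - w)) linearB mulrA lerDl rform_ge0.
Qed.

Lemma prox_uniq lam x w v : coercive -> 0 < lam -> prox lam x w ->
  prox lam x v -> w = v.
Proof.
move=> [_ _ /(_ lam)] + lam0 => /(_ lam0)[c c0 ca] wP vP.
have := prox_energy_min v (ltW lam0) wP; rewrite (prox_energy w vP).
have := ca (w - v); rewrite linearB => h1 h2.
have : c * nrm (w - v) ^+ 2 <= 0 by lra.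
rewrite pmulr_rle0// => h4; apply/eqP; rewrite -subr_eq0; apply/eqP/nrm_eq0.
by apply/eqP; rewrite -sqrf_eq0 eq_le h4 sqr_ge0.
Qed.

(* For [k -> oo], the minimizers for [lam = k + 1] form a Cauchy sequence since
   their energies increase. *)
Lemma form_domain_of_energy_bound x L : coercive ->
  (forall lam w, 0 < lam -> prox lam x w -> energy lam x w <= L) ->
  exists u, j u = x /\ a u u <= L.
Proof.
move=> ca EL; pose lam k : R := k.+1%:R.
have lam0 k : 0 < lam k by rewrite ltr0n.
have /choice[w wP] : forall k, exists w, prox (lam k) x w.
  by move=> k; exact: prox_exists.
pose phi k := energy (lam k) x (w k).
have phiL k : phi k <= L by exact: EL.
have phiS : has_sup (range phi).
  by split; [exists (phi 0%N), 0%N|exists L => _ [k _ <-]].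
have [[K K0 jK] [C aC] /(_ 1 ltr01)[c c0 cP]] := ca.
have lam1 k : 1 <= lam k by rewrite ler1n.
(* Since [lam n <= lam m], the energy of [w m] for [lam n] is at most [phi m]; expand it at its
   minimizer [w n]. As [lam n >= 1], the constant [c] for [lam = 1] serves for all [n]. *)
have phi_diff m n : (n <= m)%N -> c * nrm (w m - w n) ^+ 2 <= phi m - phi n.
  move=> nm; apply: (le_trans (cP _)); rewrite linearB.
  have : energy (lam n) x (w m) <= phi m.
    by rewrite lerD2l ler_wpM2r ?sqr_ge0// ler_nat.
  rewrite (prox_energy (w m) (wP n)) -/(phi n).
  have : 1 * nrm (j (w m) - j (w n)) ^+ 2 <= lam n * nrm (j (w m) - j (w n)) ^+ 2.
    by rewrite ler_wpM2r ?sqr_ge0.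
  lra.
have phi_le k : phi k <= sup (range phi).
  by apply: ub_le_sup; [exact: phiS.2|exists k].
have phi_nd m n : (n <= m)%N -> phi n <= phi m.
  move=> /phi_diff h; rewrite -subr_ge0 (le_trans _ h)//.
  by rewrite mulr_ge0 ?sqr_ge0// ltW.
have [u wu] : exists u, norm_cvg w u.
  apply: (@complete_nrm _ _ w c (fun k => sup (range phi) - phi k)) => //.
    move=> e e0; have [_ [k _ <-] ke] := sup_adherent e0 phiS.
    apply: filterS (nbhs_infty_ge k) => n /phi_nd; lra.
  move=> m n; have := phi_le m; have := phi_le n.
  case: (leqP n m) => [/phi_diff|/ltnW/phi_diff]; rewrite ?(nrmB (w n)); lra.
exists u; split; last first.
  apply/ler_addgt0Pr => e e0; have [n] := filter_ex (rform_lsc aC wu e0).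
  have := phiL n; rewrite /phi /energy.
  by have := mulr_ge0 (ltW (lam0 n)) (sqr_ge0 (nrm (j (w n) - x))); lra.
(* [j u = x] because [lam n * nrm (j (w n) - x) ^+ 2 <= L] with [lam n] unbounded. *)
apply/eqP; rewrite -subr_eq0; apply/eqP/nrm_eq0/eqP; rewrite eq_le nrm_ge0 andbT.
apply/ler_addgt0Pr => e e0; rewrite add0r.
have e2 : 0 < e / 2 by rewrite divr_gt0.
have eK : 0 < e / 2 / K by rewrite divr_gt0.
have L0 : 0 <= L.
  apply: le_trans (phiL 0%N); rewrite addr_ge0 ?rform_ge0//.
  by rewrite mulr_ge0 ?sqr_ge0// ltW.
have eL : 0 < (e / 2) ^+ 2 / (L + 1) by rewrite divr_gt0 ?exprn_gt0// ltr_wpDl.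
have [n [h1 h2]] := filter_ex (filterI (wu _ eK) (near_infty_natSinv_lt (PosNum eL))).
move: h2 => /=; rewrite -/(lam n) => h2.
have {}h1 : nrm (j u - j (w n)) <= e / 2.
  rewrite nrmB -linearB (le_trans (jK _))//.
  by rewrite mulrC -ler_pdivlMr// ltW.
have {}h2 : nrm (j (w n) - x) <= e / 2.
  rewrite ler_nrm ?(ltW e2)//.
  have L1 : 0 < L + 1 by lra.
  have h3 : L + 1 < (e / 2) ^+ 2 * lam n.
    move: h2; rewrite ltr_pdivlMr// mulrC ltr_pdivrMr//.
  rewrite -(ler_pM2l (lam0 n)); have := phiL n; rewrite /phi /energy.
  by have := rform_ge0 a (w n); lra.
by have := nrmD (j u - j (w n)) (j (w n) - x); rewrite addrA subrK; lra.
Qed.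

End Prox.

(** * Mosco convergence *)

Section Mosco.
Variables (R : realType) (H : hilbertType R) (V_ : nat -> hilbertType R).
Variables (j_ : forall n, {linear V_ n -> H}) (a_ : forall n, realForm (V_ n)).
Variables (V : hilbertType R) (j : {linear V -> H}) (a : realForm V).
Hypothesis a_coercive : forall n, coercive (j_ n) (a_ n).
Hypothesis acoercive : coercive j a.

Definition prox_cvg := forall (lam : R) x (w_ : forall n, V_ n) w, 0 < lam ->
  (forall n, prox (j_ n) (a_ n) lam x (w_ n)) -> prox j a lam x w ->
  norm_cvg (fun n => j_ n (w_ n)) (j w).

(* The quantifiers in front of the inequality say that the inferior limit of
   [a_ n (u_ n) (u_ n)] is at most [L]. *)
Definition mosco_liminf := forall (u_ : forall n, V_ n) x (L : R),
  weak_cvg (fun n => j_ n (u_ n)) x ->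
  (forall e N, 0 < e -> exists2 n, (N <= n)%N & a_ n (u_ n) (u_ n) <= L + e) ->
  exists u, j u = x /\ a u u <= L.

Definition mosco_limsup := forall u, exists u_ : forall n, V_ n,
  norm_cvg (fun n => j_ n (u_ n)) (j u) /\
  forall e, 0 < e -> \forall n \near \oo, a_ n (u_ n) (u_ n) < a u u + e.

Lemma prox_family (lam : R) x : 0 < lam ->
  exists w_ : forall n, V_ n, forall n, prox (j_ n) (a_ n) lam x (w_ n).
Proof.
move=> lam0; have h n := cid (prox_exists x (a_coercive n) lam0).
by exists (fun n => projT1 (h n)) => n; exact: projT2 (h n).
Qed.

(** Insert [u_ n] in the tangent inequality of [a_ n] at [w_ n]: [d n] tends to 0 strongly and [y n]
    weakly. Their product vanishes in the limit because [y n] is bounded. *)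
Lemma prox_cvg_energy_le (u_ : forall n, V_ n) x lam w :
  prox_cvg -> weak_cvg (fun n => j_ n (u_ n)) x -> 0 < lam -> prox j a lam x w ->
  forall e, 0 < e -> \forall n \near \oo, energy j a lam x w - e <= a_ n (u_ n) (u_ n).
Proof.
move=> cv ux lam0 wP e e0.
have [w_ w_P] := prox_family x lam0.
have [M uM] := weak_cvg_bounded ux.
pose s := x - j w; pose d n := j_ n (w_ n) - j w; pose y n := j_ n (u_ n) - x.
(* The terms [(d, x)], [2 (d, s)] and [2 (d, y)] are together at most [nrm d * B]. *)
pose B := nrm x + 2 * nrm s + 2 * (`|M| + nrm x) + 1.
have B0 : 0 < B.
  by rewrite ltr_wpDl// !addr_ge0 ?mulr_ge0 ?addr_ge0 ?nrm_ge0.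
have eB : 0 < e / (2 * lam * B) by rewrite divr_gt0 ?mulr_gt0.
have el : 0 < e / (4 * lam) by rewrite divr_gt0 ?mulr_gt0.
have /weak_cvgP/(_ s _ el) := ux.
have := cv lam x w_ w lam0 w_P wP _ eB.
move: uM; apply: filterS3 => n; rewrite -/(d n) -/(y n) => uMn.
rewrite !ltr_pdivlMr ?mulr_gt0// => hd hy.
have := prox_tangent (u_ n) (w_P n); rewrite (prox_energyE (w_P n)) (prox_energyE wP).
have -> : x - j_ n (w_ n) = s - d n by rewrite /s /d opprB addrA subrK.
have -> : j_ n (u_ n) - j_ n (w_ n) = y n + (s - d n).
  by rewrite /y /s /d opprB !addrA subrK subrK.
rewrite -/s -rinxx => hT.
have [yn ynE] : exists yn, yn = y n by exists (y n).
have [dn dnE] : exists dn, dn = d n by exists (d n).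
move: hT hd hy; rewrite -ynE -dnE => hT hd hy.
have yM : nrm yn <= `|M| + nrm x.
  rewrite ynE /y (le_trans (nrmD _ _))// nrmN lerD2r (le_trans uMn)//.
  exact: ler_norm.
have h1 : `|rin H dn x| <= nrm dn * nrm x := rin_le _ _.
have h2 : `|rin H dn s| <= nrm dn * nrm s := rin_le _ _.
have h3 : `|rin H dn yn| <= nrm dn * (`|M| + nrm x).
  by rewrite (le_trans (rin_le _ _))// ler_wpM2l ?nrm_ge0.
clearbody s; move: hT; rewrite !rformE (rformC _ s dn) (rformC _ s yn).
set q := (X in X <= _) => hT.
have qE : q = lam * rin H s x + lam * (rin H s s + rin H dn dn + 2 * rin H yn s
  - (rin H dn x + 2 * rin H dn s + 2 * rin H dn yn)).
  by rewrite /q; ring.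
apply: le_trans hT; rewrite qE lerD2l.
have s0 := rform_ge0 (rin H) s; have d0 := rform_ge0 (rin H) dn.
have dB : nrm dn * B = nrm dn * nrm x + 2 * (nrm dn * nrm s)
   + 2 * (nrm dn * (`|M| + nrm x)) + nrm dn by rewrite /B; ring.
have n0 := nrm_ge0 dn.
have k1 : lam * (2 * (nrm dn * B)) < e by rewrite (le_lt_trans _ hd)//; lra.
have k2 : lam * (4 * `|rin H yn s|) < e by rewrite (le_lt_trans _ hy)//; lra.
have k3 : - (rin H s s + rin H dn dn + 2 * rin H yn s
  - (rin H dn x + 2 * rin H dn s + 2 * rin H dn yn)) <=
   nrm dn * B + 2 * `|rin H yn s|.
  move: h1 h2 h3; rewrite !ler_norml => /andP[_ h1] /andP[_ h2] /andP[_ h3].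
  have := ler_norm (- rin H yn s); rewrite normrN => h4.
  by lra.
have := ler_wpM2l (ltW lam0) k3; lra.
Qed.

Lemma prox_cvg_liminf : prox_cvg -> mosco_liminf.
Proof.
move=> cv u_ x L ux uL; apply: form_domain_of_energy_bound => // lam w lam0 wP.
apply/ler_addgt0Pr => e e0; have e2 : 0 < e / 2 by rewrite divr_gt0.
have [N _ hN] := prox_cvg_energy_le cv ux lam0 wP e2.
by have [n /hN /= h1 h2] := uL _ N e2; lra.
Qed.

Lemma prox_cvg_limsup : prox_cvg -> mosco_limsup.
Proof.
move=> cv u; set x := j u.
(* One quantity for both requirements; [near_selection] then reduces the claim to a fixed [e]. *)
pose E n (v : V_ n) := Num.max (nrm (j_ n v - x)) (a_ n v v - a u u).
have [e e0|u_ uE] := @near_selection R V_ E; last first.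
  exists u_; split=> e e0; apply: filterS (uE _ e0) => n; rewrite gt_max => /andP[] //.
  by move=> _; rewrite ltrBlDr addrC.
(* Chosen so that an energy below [a u u + e = lam * e ^+ 2] bounds the form and forces distance
   less than [e] to [x]. *)
pose lam := (a u u + e) / e ^+ 2.
have ae : 0 < a u u + e by rewrite ltr_wpDl ?rform_ge0.
have lam0 : 0 < lam by rewrite divr_gt0 ?exprn_gt0.
have [w_ w_P] := prox_family x lam0.
have [w wP] := prox_exists x acoercive lam0.
have Ew : energy j a lam x w <= a u u.
  apply: le_trans (prox_energy_min u (ltW lam0) wP) _.
  by rewrite /energy subrr nrm0 expr0n mulr0 addr0.
have x0 : 0 < nrm x + 1 by rewrite ltr_wpDl// nrm_ge0.
have lx0 : 0 < lam * (nrm x + 1) by rewrite mulr_gt0.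
apply: filterS (cv lam x w_ w lam0 w_P wP _ (divr_gt0 e0 lx0)) => n.
rewrite ltr_pdivlMr// => hn; exists (w_ n).
have En : energy (j_ n) (a_ n) lam x (w_ n) < a u u + e.
  rewrite (prox_energyE (w_P n)).
  have -> : x - j_ n (w_ n) = (x - j w) - (j_ n (w_ n) - j w).
    by rewrite opprB addrA subrK.
  rewrite rformDl rformNl mulrBr -(prox_energyE wP).
  have := rin_le (j_ n (w_ n) - j w) x; rewrite ler_norml => /andP[h1 _].
  have h2 := ler_wpM2l (ltW lam0) h1.
  have := mulr_ge0 (ltW lam0) (nrm_ge0 (j_ n (w_ n) - j w)); lra.
move: En; rewrite /energy => En.
have sq0 := mulr_ge0 (ltW lam0) (sqr_ge0 (nrm (j_ n (w_ n) - x))).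
rewrite /E gt_max; apply/andP; split; last by lra.
rewrite -(@ltr_pXn2r _ 2)// ?nnegrE ?nrm_ge0 ?(ltW e0)//.
rewrite -(ltr_pM2l lam0) {2}/lam divfK ?gt_eqF ?exprn_gt0//.
by have := rform_ge0 (a_ n) (w_ n); lra.
Qed.

Hypothesis jdense : forall x e, 0 < e -> exists u, nrm (j u - x) < e.

Lemma mosco_limsup_dense x : mosco_limsup ->
  exists u_ : forall n, V_ n, norm_cvg (fun n => j_ n (u_ n)) x.
Proof.
move=> ms; apply: (@near_selection R V_ (fun n v => nrm (j_ n v - x))) => e e0.
have e2 : 0 < e / 2 by rewrite divr_gt0.
have [u ux] := jdense x e2; have [u_ [uu _]] := ms u.
apply: filterS (uu _ e2) => n h; exists (u_ n).
by have := nrmD (j_ n (u_ n) - j u) (j u - x); rewrite addrA subrK; lra.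
Qed.

(* Otherwise a subsequence of [w_] with too small energies converges weakly;
   completed by a strongly convergent sequence it contradicts [mosco_liminf]. *)
Lemma mosco_energy_ge (lam : R) x (w_ : forall n, V_ n) w :
  mosco_liminf -> mosco_limsup -> 0 < lam ->
  (forall n, prox (j_ n) (a_ n) lam x (w_ n)) -> prox j a lam x w ->
  forall e, 0 < e -> \forall n \near \oo,
    energy j a lam x w - e < energy (j_ n) (a_ n) lam x (w_ n).
Proof.
move=> mi ms lam0 w_P wP e e0; apply: contrapT => /not_near_infty Sinf.
(* Compare with the energy of 0, which is [lam * nrm x ^+ 2]. *)
have bnd n : nrm (j_ n (w_ n)) <= 2 * nrm x.
  have := prox_energy_min 0 (ltW lam0) (w_P n).
  rewrite /energy linear0 rform0l !add0r nrmN => h.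
  have : nrm (j_ n (w_ n) - x) <= nrm x.
    rewrite ler_nrm ?nrm_ge0// -(ler_pM2l lam0).
    by have := rform_ge0 (a_ n) (w_ n); lra.
  by have := nrmD (j_ n (w_ n) - x) x; rewrite subrK; lra.
have [T [z [TS Tinf Tz]]] := weak_compactness bnd Sinf.
have [v_ vz] := mosco_limsup_dense z ms.
pose u_ n := if `[< T n >] then w_ n else v_ n.
have uz : weak_cvg (fun n => j_ n (u_ n)) z.
  apply/weak_cvgP => y d d0.
  have y0 : 0 < nrm y + 1 by rewrite ltr_wpDl// nrm_ge0.
  have dy : 0 < d / (nrm y + 1) by rewrite divr_gt0.
  apply: filterS2 (Tz y _ d0) (vz _ dy) => n h1; rewrite ltr_pdivlMr// => h2.
  rewrite /u_; case: asboolP => [/h1//|_].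
  apply: (le_lt_trans (rin_le _ _)); apply: le_lt_trans h2.
  by rewrite ler_wpM2l ?nrm_ge0// lerDl.
(* Along [T] the form is at most [L] in the limit, the cross term with [z - x] vanishing weakly. A
   [u] with [j u = z] and [a u u <= L] would have energy at least [e] below the minimum. *)
pose L := energy j a lam x w - e - lam * nrm (z - x) ^+ 2.
have [d N d0|u [uz' uL]] := mi u_ z L uz.
  have dl : 0 < d / (2 * lam) by rewrite divr_gt0 ?mulr_gt0.
  have [N' _ h'] := Tz (z - x) _ dl.
  have [n nN Tn] := Tinf (maxn N N'); exists n; first exact: leq_trans (leq_maxl _ _) nN.
  have := h' n (leq_trans (leq_maxr _ _) nN) Tn.
  rewrite ltr_pdivlMr ?mulr_gt0// => hz.
  have /negP := TS _ Tn; rewrite -leNgt {1}/energy /u_ asboolT//.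
  have -> : j_ n (w_ n) - x = (j_ n (w_ n) - z) + (z - x) by rewrite addrA subrK.
  rewrite -rinxx rformDD rinxx rinxx /L.
  have := mulr_ge0 (ltW lam0) (sqr_ge0 (nrm (j_ n (w_ n) - z))).
  have := ler_norm (- rin H (j_ n (w_ n) - z) (z - x)); rewrite normrN.
  by move/(ler_wpM2l (ltW lam0)); lra.
have := prox_energy_min u (ltW lam0) wP; move: uL.
by rewrite {2}/energy uz' /L; lra.
Qed.

(** The energy of a recovery sequence [r_] for [w] comes close to the minimal energies, and
    [prox_energy] turns this gap into closeness of [j_ n (r_ n)] and [j_ n (w_ n)]. *)
Lemma mosco_prox_cvg : mosco_liminf -> mosco_limsup -> prox_cvg.
Proof.
move=> mi ms lam x w_ w lam0 w_P wP e e0.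
have [r_ [rw ra]] := ms w.
(* Three errors of size [d]: the form at [r_ n], its distance term (through [B]), and the lower
   bound on the minimal energy. *)
pose d := lam * (e / 2) ^+ 2 / 3.
have e2 : 0 < e / 2 by rewrite divr_gt0.
have d0 : 0 < d by rewrite !divr_gt0// mulr_gt0// exprn_gt0.
pose B := lam * (2 * nrm (j w - x) + 1).
have B0 : 0 < B by rewrite mulr_gt0// ltr_wpDl// mulr_ge0 ?nrm_ge0.
have dB : 0 < d / B by rewrite divr_gt0.
near=> n.
have h1 : nrm (j_ n (r_ n) - j w) < e / 2 by near: n; exact: rw.
have h2 : nrm (j_ n (r_ n) - j w) < 1 by near: n; exact: rw.
have : nrm (j_ n (r_ n) - j w) < d / B by near: n; exact: rw.
rewrite ltr_pdivlMr// => h3.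
have h4 : a_ n (r_ n) (r_ n) < a w w + d by near: n; exact: ra.
have h5 : energy j a lam x w - d < energy (j_ n) (a_ n) lam x (w_ n).
  by near: n; exact: mosco_energy_ge.
have := prox_energy (r_ n) (w_P n); have := rform_ge0 (a_ n) (r_ n - w_ n).
move: h5; rewrite {1 3}/energy => h5 h6 h7.
have h8 : nrm (j_ n (r_ n) - x) ^+ 2 <=
    (nrm (j_ n (r_ n) - j w) + nrm (j w - x)) ^+ 2.
  rewrite -ler_nrm ?addr_ge0 ?nrm_ge0//.
  by have := nrmD (j_ n (r_ n) - j w) (j w - x); rewrite addrA subrK.
have h9 : (nrm (j_ n (r_ n) - j w) + nrm (j w - x)) ^+ 2 <= nrm (j w - x) ^+ 2 +
    nrm (j_ n (r_ n) - j w) * (2 * nrm (j w - x) + 1).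
  have s1 : 0 <= 1 - nrm (j_ n (r_ n) - j w) by rewrite subr_ge0 ltW.
  by have := mulr_ge0 (nrm_ge0 (j_ n (r_ n) - j w)) s1; lra.
have := ler_wpM2l (ltW lam0) (le_trans h8 h9); move: h3; rewrite /B => h3 h10.
have : lam * nrm (j_ n (r_ n) - j_ n (w_ n)) ^+ 2 < lam * (e / 2) ^+ 2.
  have -> : lam * (e / 2) ^+ 2 = 3 * d by rewrite /d; field.
  lra.
rewrite ltr_pM2l// ltr_pXn2r// ?nnegrE ?nrm_ge0 ?(ltW e2)// => h11.
have := nrmD (j_ n (w_ n) - j_ n (r_ n)) (j_ n (r_ n) - j w).
by rewrite addrA subrK (nrmB _ (j_ n (r_ n))); lra.
Unshelve. all: by end_near. Qed.

Lemma prox_cvgP : prox_cvg <-> mosco_liminf /\ mosco_limsup.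
Proof.
split=> [cv|[]]; last exact: mosco_prox_cvg.
by split; [exact: prox_cvg_liminf|exact: prox_cvg_limsup].
Qed.

End Mosco.

(** * Resolvents of associated operators *)

Section SesquilinearForm.
Variables (R : realType) (V H : hilbertType R).
Variables (j : {linear V -> H}) (a : {sesquilinear V}).
Hypothesis a_ge0 : positive_form a.

Lemma elliptic_coercive : bounded_operator j -> elliptic j a ->
  coercive j (reForm a_ge0).
Proof.
move=> [M jM] [acont [omega [mu [mu0 amu]]]]; split.
- exists (1 + `|M|) => [|u]; first by rewrite ltr_pwDl.
  have := jM u; rewrite !nrmE -rmorphM lecR => /le_trans; apply.
  by rewrite ler_wpM2r ?nrm_ge0// (le_trans (ler_norm M))// lerDr.
- have : (fun u : V => a u u : R[i]^o) @ (0 : V) --> (0 : R[i]^o).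
    have -> : (0 : R[i]^o) = a 0 0 by rewrite linear0l.
    apply: (cvg_comp (fun u : V => (u, u)) _ _ (acont (0, 0))).
    exact: cvg_pair.
  move=> /cvgrPdist_lt/(_ 1 ltr01)/nbhs_ballP[[d d']].
  rewrite /= ltcE /= => /andP[/eqP -> {d'} d0] dP.
  (* Rescale [u] to norm [d / 2], inside the ball where the form is less than 1. *)
  exists ((d / 2) ^- 2) => u; rewrite -[leLHS]/(reForm a_ge0 u u).
  have [u0|u0] := eqVneq (nrm u) 0.
    by rewrite (nrm_eq0 u0) nrm0 expr0n mulr0 rform0l.
  have up : 0 < nrm u by rewrite lt_def u0 nrm_ge0.
  pose t := d / 2 / nrm u.
  have t0 : 0 < t by rewrite !divr_gt0.
  have /dP : ball (0 : V) d%:C (t%:C *: u).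
    rewrite -ball_normE /= sub0r normrN nrmE ltcR nrmZ gtr0_norm// divfK//.
    by rewrite gtr_pMr// invf_lt1// ltr1n.
  rewrite /= sub0r normrN => h.
  have : reForm a_ge0 (t%:C *: u) (t%:C *: u) <= 1.
    rewrite -lecR; apply: ltW; apply: le_lt_trans h.
    by apply: le_trans (normc_ge_Re _); rewrite lecR ler_norm.
  rewrite !rformE mulrA -expr2 mulrC -ler_pdivlMr ?exprn_gt0// div1r.
  by rewrite /t exprMn invfM exprVn invrK.
(* Weigh ellipticity by [t] and positivity by [1 - t]; this [t] is at most 1 and satisfies
   [t * |omega| <= lam]. *)
- move=> lam lam0; pose t := lam / (lam + `|omega|).
  have lo : 0 < lam + `|omega| by rewrite ltr_pwDl.
  have t0 : 0 < t by rewrite divr_gt0.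
  exists (t * mu) => [|u]; first by rewrite mulr_gt0.
  have := amu u; rewrite !nrmE -!rmorphXn -!rmorphM -rmorphB lecR => h.
  have t1 : t <= 1 by rewrite ler_pdivrMr// mul1r lerDl.
  have to : t * `|omega| <= lam.
    by rewrite mulrAC ler_pdivrMr// ler_pM2l// lerDr ltW.
  have := ler_wpM2r (sqr_ge0 (nrm (j u))) to.
  have : t * reForm a_ge0 u u <= reForm a_ge0 u u.
    by rewrite ler_piMl// rform_ge0.
  have : mu * nrm u ^+ 2 <= reForm a_ge0 u u + `|omega| * nrm (j u) ^+ 2.
    apply: (le_trans h); rewrite lerD2l -mulNr ler_wpM2r ?sqr_ge0//.
    by rewrite -normrN ler_norm.
  move=> /(ler_wpM2l (ltW t0)); lra.
Qed.

(* A complex functional is determined by its real part: replace [v] by [i v]. *)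
Lemma eq_form_of_Re u (g : H) :
  (forall v, reForm a_ge0 u v = rin H g (j v)) <->
  (forall v, a u v = inner g (j v)).
Proof.
split=> h v; last by rewrite rinE -h.
have conj_i : Num.conj ('i%C : R[i]) = - 'i%C by rewrite complexiE conjCi.
have := h v; have := h ('i%C *: v); rewrite !rinE linearZ /=.
rewrite !linearZr_LR /= conj_i.
case: (a u v) (inner g (j v)) => [p p'] [q q'] /=.
by rewrite !mulN1r oppr0 !mul0r !sub0r !opprK => -> ->.
Qed.

Lemma resolventE (lam : R) x w : coercive j (reForm a_ge0) -> 0 < lam ->
  prox j (reForm a_ge0) lam x w ->
  resolvent (associated_operator j a) lam (lam%:C *: x) = j w.
Proof.
move=> ca lam0 wP; apply: xget_unique => /=.
  (* By the Euler equation this is the value of the operator at [j w]. *)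
  exists (lam%:C *: (x - j w)); last by rewrite -scalerDr addrC subrK.
  exists w; split=> //=; apply/eq_form_of_Re => v.
  by rewrite wP rformZl.
move=> _ [f [u /= [<- /eq_form_of_Re uP]] fE].
congr (j _); apply: (prox_uniq ca lam0 _ wP) => v.
by rewrite uP -rformZl scalerBr -fE addrAC subrr add0r.
Qed.

End SesquilinearForm.

Local Open Scope ereal_scope.

Theorem theorem3p1 (R : realType) (H : hilbertType R)
  (V_ : nat -> hilbertType R)
  (j_ : forall n, {linear V_ n -> H})
  (a_ : forall n, {sesquilinear (V_ n)})
  (V : hilbertType R) (j : {linear V -> H}) (a : {sesquilinear V})
  (j_bounded : forall n, bounded_operator (j_ n))
  (j_dense : forall n, dense_range (j_ n))
  (a_positive : forall n, positive_form (a_ n))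
  (a_elliptic : forall n, elliptic (j_ n) (a_ n))
  (jbounded : bounded_operator j)
  (jdense : dense_range j)
  (apositive : positive_form a)
  (aelliptic : elliptic j a) :
  strong_resolvent_cvg_opp (fun n => associated_operator (j_ n) (a_ n))
    (associated_operator j a)
  <->
  (forall (u_ : forall n, V_ n) (x : H),
     weak_cvg (fun n => j_ n (u_ n)) x ->
     limn_einf (fun n => qform (a_ n) (u_ n)) < +oo ->
     exists u : V, j u = x /\
       qform a u <= limn_einf (fun n => qform (a_ n) (u_ n)))
  /\
  (forall u : V, exists u_ : forall n, V_ n,
     (fun n => j_ n (u_ n)) @ \oo --> j u /\
     limn_esup (fun n => qform (a_ n) (u_ n)) <= qform a u).
Proof.
pose A_ n := reForm (a_positive n); pose A := reForm apositive.
have cA_ n : coercive (j_ n) (A_ n) by exact: elliptic_coercive.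
have cA : coercive j A by exact: elliptic_coercive.
have resolventP : strong_resolvent_cvg_opp (fun n => associated_operator (j_ n) (a_ n))
    (associated_operator j a) <-> prox_cvg j_ A_ j A.
  split=> [src lam x w_ w lam0 w_P wP|cv x lam lam0].
    apply/cvg_nrmP; have := src (lam%:C%C *: x)%R lam lam0.
    rewrite (resolventE cA lam0 wP).
    by under eq_fun do rewrite (resolventE (cA_ _) lam0 (w_P _)).
  (* The minimizers for [x] give the resolvents at [lam x], hence the rescaling by [lam^-1]. *)
  have [w_ w_P] := prox_family cA_ (lam^-1%:C%C *: x)%R lam0.
  have [w wP] := prox_exists (lam^-1%:C%C *: x)%R cA lam0.
  have xE : x = (lam%:C%C *: (lam^-1%:C%C *: x))%R.
    by rewrite scalerA -rmorphM divff ?gt_eqF// scale1r.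
  rewrite xE (resolventE cA lam0 wP).
  under eq_fun do rewrite (resolventE (cA_ _) lam0 (w_P _)).
  by apply/cvg_nrmP; exact: cv lam0 w_P wP.
have jd x e : (0 < e)%R -> exists u, (nrm (j u - x) < e)%R.
  move=> e0; have [|y [xy [u _ uy]]] := jdense (ball x e%:C%C) _ (ball_open _ _).
    by exists x; apply: ballxx; rewrite ltcR.
  by exists u; move: xy; rewrite uy -ball_normE /= nrmE ltcR nrmB.
apply: (iff_trans resolventP); apply: (iff_trans (prox_cvgP cA_ cA jd)).
split=> -[hinf hsup]; split.
- move=> u_ x ux; set l := limn_einf _ => ly.
  have l0 : 0 <= l.
    apply: le_limn_einf => e e0; apply: filterE => n.
    by rewrite sub0r (le_trans _ (rform_ge0 (A_ n) _))// oppr_le0 ltW.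
  have lfin : l \is a fin_num by rewrite ge0_fin_numE.
  have [e N e0|u [jux Au]] := hinf u_ x (fine l) ux.
    (* Otherwise the forms exceed [l + e] from [N] on, and so would their inferior limit [l]. *)
    apply: contrapT => h; have : (fine l + e)%:E <= l.
      apply: le_limn_einf => d d0; exists N => // n /= Nn.
      have [//|lt] := leP (fine l + e - d)%R (A_ n (u_ n) (u_ n)).
      by case: h; exists n => //; rewrite (le_trans (ltW lt))// gerBl ltW.
    by rewrite -[leRHS]fineK// lee_fin gerDl leNgt e0.
  by exists u; split=> //; rewrite -(fineK lfin) lee_fin.
- move=> u; have [u_ [uu uA]] := hsup u.
  exists u_; split; first exact/cvg_nrmP.
  by apply: limn_esup_le => e e0; apply: filterS (uA _ e0) => n /ltW.
- move=> u_ x L ux uL.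
  have lL : limn_einf (fun n => qform (a_ n) (u_ n)) <= L%:E.
    apply/lee_addgt0Pr => e e0; rewrite -EFinD.
    by apply: limn_einf_le => N; exact: uL.
  have [|u [jux Au]] := hinf u_ x ux; first exact: le_lt_trans lL (ltry _).
  by exists u; split=> //; rewrite -lee_fin; exact: le_trans Au lL.
- move=> u; have [u_ [uu uA]] := hsup u.
  exists u_; split; first exact/cvg_nrmP.
  exact: limn_esup_lt.
Qed.
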